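(* Let $R$ be a commutative ring and let $(A,\underline\sigma,\underline D)$ be an $n$-twisted differential $R$-algebra of Schwarz type. If $M$ is a (left) $\mathrm D_{A/R,\underline\sigma,\underline D}$-module, then the maps $D_{M,i}:M\to M$, $s\mapsto\partial_i s$ ($i=1,\ldots,n$), turn $M$ into an integrable $\underline D_A$-module, and this defines an equivalence (in fact an isomorphism) of categories $$\mathrm D_{A/R,\underline\sigma,\underline D}\text{-}\mathrm{Mod}\simeq\underline D_A\text{-}\mathrm{Mod}^{\mathrm{int}}.$$
   Context: An $n$-twisted differential $R$-algebra $(A,\underline\sigma,\underline D)$ is a commutative $R$-algebra $A$ with $n$ pairwise commuting $R$-algebra endomorphisms $\sigma_1,\ldots,\sigma_n$ and, for each $i$, a $\sigma_i$-derivation $D_i$ of $A$, i.e. an $R$-linear map $D_i:A\to A$ with $D_i(xy)=D_i(x)y+\sigma_i(x)D_i(y)$. It is of Schwarz type if $D_iD_j=D_jD_i$ for all $i,j$ and $\sigma_iD_j=D_j\sigma_i$ whenever $i\neq j$. $\mathrm D_{A/R,\underline\sigma,\underline D}$ (the Ore extension of $A$ by $\underline\sigma$ and $\underline D$, a twisted Weyl algebra) is the unique $R$-algebra containing $A$ as a subalgebra which is a free left $A$-module on the monomials $\partial_1^{k_1}\cdots\partial_n^{k_n}$, $\underline k\in\mathbb N^n$, in pairwise commuting elements $\partial_1,\ldots,\partial_n$ with $\partial_i x=D_i(x)+\sigma_i(x)\partial_i$ for all $x\in A$ and all $i$. A $\underline D_A$-module is an $A$-module $M$ with, for each $i$, a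 $D_i$-derivation $D_{M,i}$ of $M$, i.e. an $R$-linear map $D_{M,i}:M\to M$ with $D_{M,i}(xs)=D_i(x)s+\sigma_i(x)D_{M,i}(s)$ for $x\in A$, $s\in M$. It is integrable if the $D_{M,i}$ commute with each other. Morphisms are $A$-linear maps $u:M\to N$ with $u\circ D_{M,i}=D_{N,i}\circ u$ for all $i$. $\underline D_A\text{-}\mathrm{Mod}^{\mathrm{int}}$ is the full subcategory of integrable $\underline D_A$-modules. *)

(* Defs.v *)
From HB Require Import structures.
From mathcomp Require Import all_boot all_order all_algebra.
From mathcomp Require Import boolp.

Set Implicit Arguments.
Unset Strict Implicit.
Unset Printing Implicit Defensive.

Import GRing.Theory.
Local Open Scope ring_scope.

(** * Categories *)

Record category := Category {
  obj :> Type;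
  hom : obj -> obj -> Type;
  idm : forall X, hom X X;
  comp : forall X Y Z, hom Y Z -> hom X Y -> hom X Z;
  comp_idl : forall X Y (f : hom X Y), comp (idm Y) f = f;
  comp_idr : forall X Y (f : hom X Y), comp f (idm X) = f;
  compA : forall X Y Z T (h : hom Z T) (g : hom Y Z) (f : hom X Y),
    comp h (comp g f) = comp (comp h g) f }.

Arguments hom {c} X Y.
Arguments idm {c} X.
Arguments comp {c X Y Z} g f.

Definition is_iso (C : category) (X Y : C) (f : hom X Y) : Prop :=
  exists g : hom Y X, comp g f = idm X /\ comp f g = idm Y.

Record functor (C D : category) := Functor {
  fobj :> C -> D;
  fmap : forall X Y : C, hom X Y -> hom (fobj X) (fobj Y);
  fmap_id : forall X : C, fmap (idm X) = idm (fobj X);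
  fmap_comp : forall (X Y Z : C) (g : hom Y Z) (f : hom X Y),
    fmap (comp g f) = comp (fmap g) (fmap f) }.

Arguments fmap {C D} F {X Y} f : rename.

Definition functor_id (C : category) : functor C C :=
  @Functor C C id (fun _ _ f => f) (fun _ => erefl) (fun _ _ _ _ _ => erefl).

Definition functor_comp (C D E : category) (G : functor D E) (F : functor C D) :
  functor C E.
Proof.
refine (@Functor C E (fun X => G (F X)) (fun _ _ f => fmap G (fmap F f)) _ _).
- by move=> X; rewrite !fmap_id.
- by move=> X Y Z g f; rewrite !fmap_comp.
Defined.

Definition naturally_isomorphic (C D : category) (F G : functor C D) : Prop :=
  exists t : forall X : C, hom (F X) (G X),
    (forall (X Y : C) (f : hom X Y),
       comp (t Y) (fmap F f) = comp (fmap G f) (t X)) /\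
    (forall X : C, is_iso (t X)).

Definition is_equivalence (C D : category) (F : functor C D) : Prop :=
  exists G : functor D C,
    naturally_isomorphic (functor_comp G F) (functor_id C) /\
    naturally_isomorphic (functor_comp F G) (functor_id D).

(* The two equalities are strict equalities of functors. *)
Definition is_isomorphism (C D : category) (F : functor C D) : Prop :=
  exists G : functor D C,
    functor_comp G F = functor_id C /\ functor_comp F G = functor_id D.

Definition full_subcategory (C : category) (P : C -> Prop) : category :=
  @Category {X : C | P X} (fun X Y => hom (sval X) (sval Y))
    (fun X => idm (sval X)) (fun _ _ _ g f => comp g f)
    (fun _ _ f => comp_idl f) (fun _ _ f => comp_idr f)
    (fun _ _ _ _ h g f => compA h g f).

(** * The category of left modules over a ring *)

Lemma linear_ext (B : pzRingType) (M N : lmodType B) (f g : {linear M -> N}) :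
  f =1 g -> f = g.
Proof.
case: f => f [[f1] [f2]]; case: g => g [[g1] [g2]] /= /funext fg.
move: g1 g2; rewrite -fg => g1 g2.
by rewrite (Prop_irrelevance f1 g1) (Prop_irrelevance f2 g2).
Qed.

Definition lmod_cat (B : pzRingType) : category.
Proof.
refine (@Category (lmodType B) (fun M N => {linear M -> N})
  (fun M => idfun : {linear M -> M})
  (fun M N P (g : {linear N -> P}) (f : {linear M -> N}) =>
     g \o f : {linear M -> P}) _ _ _).
all: by move=> *; apply: linear_ext.
Defined.

Section RestrictionOfScalars.
Variables (A B : pzRingType) (j : {rmorphism A -> B}).

Definition restr_sort (M : lmodType B) : Type := M.

Section Module.
Variable M : lmodType B.

HB.instance Definition _ := GRing.Zmodule.on (restr_sort M).

Definition restr_scale (a : A) (s : restr_sort M) : restr_sort M :=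
  j a *: (s : M).

Lemma restr_scaleA a b s :
  restr_scale a (restr_scale b s) = restr_scale (a * b) s.
Proof. by rewrite /restr_scale scalerA rmorphM. Qed.

Lemma restr_scale1 : left_id 1 restr_scale.
Proof. by move=> s; rewrite /restr_scale rmorph1 scale1r. Qed.

Lemma restr_scaleDr : right_distributive restr_scale +%R.
Proof. by move=> a s t; apply: scalerDr. Qed.

Lemma restr_scaleDl s : {morph restr_scale^~ s : a b / a + b}.
Proof. by move=> a b; rewrite /restr_scale rmorphD scalerDl. Qed.

Definition restr : lmodType A :=
  HB.pack (restr_sort M)
    (GRing.Zmodule_isLmodule.Build A (restr_sort M)
       restr_scaleA restr_scale1 restr_scaleDr restr_scaleDl).

End Module.

Section Morphism.
Variables (M N : lmodType B) (f : {linear M -> N}).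

Definition restr_fun : restr M -> restr N := f.

Lemma restr_fun_linear : linear restr_fun.
Proof. by move=> a s t; apply: linearP. Qed.

Definition restr_hom : {linear restr M -> restr N} :=
  HB.pack restr_fun
    (GRing.isLinear.Build A (restr M) (restr N) *:%R restr_fun
       restr_fun_linear).

End Morphism.
End RestrictionOfScalars.

(** * Twisted differential algebras *)

(* A commutative R-algebra is encoded as a commutative ring together with its
   structure morphism, because [comAlgType R] excludes the zero algebra. *)
Record twistedDiffAlg (R : comPzRingType) (n : nat) := TwistedDiffAlg {
  tda_ring :> comPzRingType;
  tda_of : {rmorphism R -> tda_ring};
  tda_sigma : 'I_n -> {rmorphism tda_ring -> tda_ring};
  tda_der : 'I_n -> {additive tda_ring -> tda_ring};
  tda_sigma_alg : forall i r, tda_sigma i (tda_of r) = tda_of r;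
  tda_sigmaC : forall i j x,
    tda_sigma i (tda_sigma j x) = tda_sigma j (tda_sigma i x);
  tda_derZ : forall i r x, tda_der i (tda_of r * x) = tda_of r * tda_der i x;
  tda_derM : forall i x y,
    tda_der i (x * y) = tda_der i x * y + tda_sigma i x * tda_der i y }.

Arguments tda_of {R n} A : rename.
Arguments tda_sigma {R n} A i : rename.
Arguments tda_der {R n} A i : rename.

Definition schwarz_type (R : comPzRingType) (n : nat)
    (A : twistedDiffAlg R n) : Prop :=
  (forall i j x, tda_der A i (tda_der A j x) = tda_der A j (tda_der A i x)) /\
  (forall i j x, i != j ->
     tda_sigma A i (tda_der A j x) = tda_der A j (tda_sigma A i x)).

(** * The Ore extension *)

Definition monomial (B : pzRingType) (n : nat) (d : 'I_n -> B)
    (k : {ffun 'I_n -> nat}) : B :=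
  \prod_(i < n) d i ^+ k i.

(* The defining characterization of the Ore extension; [ore_central] says that
   the ring is an R-algebra through A, and [ore_span] and [ore_free] that the
   monomials form a basis of it as a left A-module. *)
Record oreExtension (R : comPzRingType) (n : nat) (A : twistedDiffAlg R n) :=
  OreExtension {
  ore_ring :> pzRingType;
  ore_of : {rmorphism A -> ore_ring};
  ore_d : 'I_n -> ore_ring;
  ore_of_inj : injective ore_of;
  ore_central : forall r P, ore_of (tda_of A r) * P = P * ore_of (tda_of A r);
  ore_dC : forall i j, ore_d i * ore_d j = ore_d j * ore_d i;
  ore_rel : forall i x,
    ore_d i * ore_of x
    = ore_of (tda_der A i x) + ore_of (tda_sigma A i x) * ore_d i;
  ore_span : forall P : ore_ring,
    exists (s : seq {ffun 'I_n -> nat}) (c : {ffun 'I_n -> nat} -> A),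
      P = \sum_(k <- s) ore_of (c k) * monomial ore_d k;
  ore_free : forall (s : seq {ffun 'I_n -> nat}) (c : {ffun 'I_n -> nat} -> A),
    uniq s -> \sum_(k <- s) ore_of (c k) * monomial ore_d k = 0 ->
    forall k, k \in s -> c k = 0 }.

Arguments ore_of {R n A} E : rename.
Arguments ore_d {R n A} E i : rename.

(** * Modules with twisted derivations *)

Section DModules.
Variables (R : comPzRingType) (n : nat) (A : twistedDiffAlg R n).

Definition is_derivation (M : lmodType A) (i : 'I_n) (d : M -> M) : Prop :=
  [/\ forall s t, d (s + t) = d s + d t,
      forall r s, d (tda_of A r *: s) = tda_of A r *: d s &
      forall x s, d (x *: s) = tda_der A i x *: s + tda_sigma A i x *: d s].

Definition commuting (M : lmodType A) (d : 'I_n -> M -> M) : Prop :=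
  forall i j s, d i (d j s) = d j (d i s).

Record dModule := DModule {
  dm_mod :> lmodType A;
  dm_der : 'I_n -> dm_mod -> dm_mod;
  dm_derP : forall i, is_derivation i (dm_der i) }.

Definition integrable (M : dModule) : Prop := commuting (@dm_der M).

Record dHom (M N : dModule) := DHom {
  dh_lin :> {linear dm_mod M -> dm_mod N};
  dh_der : forall i s, dh_lin (dm_der i s) = dm_der i (dh_lin s) }.

Lemma dHom_ext (M N : dModule) (u v : dHom M N) : u =1 v -> u = v.
Proof.
case: u => u u1; case: v => v v1 /= /linear_ext uv; subst v.
by rewrite (Prop_irrelevance u1 v1).
Qed.

Definition dHom_id (M : dModule) : dHom M M :=
  @DHom M M idfun (fun _ _ => erefl).

Lemma dHom_comp_subproof (M N P : dModule) (v : dHom N P) (u : dHom M N) i s :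
  (v \o u) (dm_der i s) = dm_der i ((v \o u) s).
Proof. by rewrite /= !dh_der. Qed.

Definition dHom_comp (M N P : dModule) (v : dHom N P) (u : dHom M N) :
  dHom M P := DHom (dHom_comp_subproof v u).

Definition dModule_cat : category.
Proof.
refine (@Category dModule dHom dHom_id dHom_comp _ _ _).
all: by move=> *; apply: dHom_ext.
Defined.

Definition intModule_cat : category := @full_subcategory dModule_cat integrable.

End DModules.

(** * From modules over the Ore extension to modules with derivations *)

Section OreToInt.
Variables (R : comPzRingType) (n : nat) (A : twistedDiffAlg R n).
Variable E : oreExtension A.

Definition ore_act (M : lmodType E) (i : 'I_n) (s : restr (ore_of E) M) :
    restr (ore_of E) M :=
  ore_d E i *: (s : M).

Arguments ore_act M i s : clear implicits.

Lemma ore_act_derivation (M : lmodType E) i : is_derivation i (ore_act M i).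
Proof.
split=> [s t | r s | x s].
- exact: (@scalerDr _ M).
- rewrite /ore_act; change (ore_d E i *: (ore_of E (tda_of A r) *: (s : M)) =
    ore_of E (tda_of A r) *: (ore_d E i *: (s : M))).
  by rewrite !scalerA ore_central.
- rewrite /ore_act; change (ore_d E i *: (ore_of E x *: (s : M)) =
    ore_of E (tda_der A i x) *: (s : M) +
    ore_of E (tda_sigma A i x) *: (ore_d E i *: (s : M))).
  by rewrite !scalerA ore_rel scalerDl.
Qed.

Lemma ore_act_commuting (M : lmodType E) : commuting (ore_act M).
Proof.
move=> i j s; change (ore_d E i *: (ore_d E j *: (s : M)) =
  ore_d E j *: (ore_d E i *: (s : M))).
by rewrite !scalerA ore_dC.
Qed.

Definition ore_to_int_obj (M : lmodType E) : intModule_cat A :=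
  exist (@integrable R n A) (DModule (@ore_act_derivation M))
    (@ore_act_commuting M).

Lemma ore_to_int_hom_subproof (M N : lmodType E) (f : {linear M -> N}) i s :
  restr_hom (ore_of E) f (ore_act M i s)
  = ore_act N i (restr_hom (ore_of E) f s).
Proof. exact: linearZ. Qed.

Definition ore_to_int_hom (M N : lmodType E) (f : {linear M -> N}) :
    dHom (sval (ore_to_int_obj M)) (sval (ore_to_int_obj N)) :=
  @DHom R n A (sval (ore_to_int_obj M)) (sval (ore_to_int_obj N))
    (restr_hom (ore_of E) f) (ore_to_int_hom_subproof f).

Definition ore_to_int : functor (lmod_cat E) (intModule_cat A).
Proof.
refine (@Functor (lmod_cat E) (intModule_cat A)
  ore_to_int_obj ore_to_int_hom _ _).
all: by move=> *; apply: dHom_ext.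
Defined.

End OreToInt.

Arguments ore_act {R n A} E M i s.

(* Main.v *)
Require Import Defs.
From HB Require Import structures.
From mathcomp Require Import all_boot all_order all_algebra.
From mathcomp Require Import boolp.

Set Implicit Arguments.
Unset Strict Implicit.
Unset Printing Implicit Defensive.

Import GRing.Theory.
Local Open Scope ring_scope.

(** The content of the statement is that an integrable module [M] over [A]
with derivations [D_i] carries exactly one structure of module over the Ore
extension [E] in which [A] acts as given and [ore_d E i] acts as [D_i].

Existence.  Since the monomials in the [ore_d E i] form a basis of [E] over
[A], an element [\sum_k a_k d^k] can be made to act on [M] as
[\sum_k a_k D^k]; freeness makes this well defined ([mod_eval_eq]).  The
point is that this action is multiplicative ([actM]).  As [E] is generated by
[A] and the [ore_d E i], it is enough that left multiplication by a generator
goes to the right operator: for [A] this is clear ([act_ore_of]), and for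
[ore_d E i] ([act_ore_d]) one moves it across a coefficient, by the defining
relation of [E] on one side and the twisted Leibniz rule on the other, and
absorbs it into the monomial, using the commutation of the [ore_d E i] on one
side and integrability on the other ([ore_d_monomial], [mono_op_incr]).
Freeness is only used through well-definedness; everything afterwards is an
induction on generators ([ore_ind]).

Uniqueness ([act_unique]) is the same induction, and so is the fact that maps
commuting with [A] and the derivations are [E]-linear ([act_dHom]).

Both constructions keep the underlying additive group and the underlying maps
of morphisms.  Hence they are inverse to each other on the nose: a module is
determined by its additive group and its scalar multiplication
([module_of_eq]), and the equalities of objects obtained in this way
transport morphisms by the identity ([eq_hom_lmodE], [eq_hom_intModuleE]),
which is what equality of functors requires ([functor_ext]). *)

(** * Equality of functors *)

Definition eq_hom (C : category) (X Y : C) (p : X = Y) : Defs.hom X Y :=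
  eq_rect X (Defs.hom X) (idm X) Y p.

(** Equality of the actions on morphisms only makes sense after transport along
the equalities of objects. Phrasing it as a naturality square for [eq_hom]
avoids dependent casts on both ends of a hom-set at once. *)
Lemma functor_ext (C D : category) (F G : functor C D)
    (p : forall X, F X = G X) :
  (forall (X Y : C) (f : Defs.hom X Y),
     Defs.comp (eq_hom (p Y)) (fmap F f)
     = Defs.comp (fmap G f) (eq_hom (p X))) ->
  F = G.
Proof.
case: F p => Fo Fm F1 F2; case: G => Go Gm G1 G2 /= p.
have oE : Fo = Go by apply: funext.
case: Go / oE Gm G1 G2 p => Gm G1 G2 p pE.
have mE : Fm = Gm.
  apply: functional_extensionality_dep => X.
  apply: functional_extensionality_dep => Y.
  apply: funext => f; have := pE X Y f.
  rewrite (Prop_irrelevance (p X) erefl) (Prop_irrelevance (p Y) erefl) /=.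
  by rewrite comp_idl comp_idr.
case: Gm / mE G1 G2 {pE} => G1 G2.
by rewrite (Prop_irrelevance F1 G1) (Prop_irrelevance F2 G2).
Qed.

Lemma naturally_isomorphic_refl (C D : category) (F : functor C D) :
  naturally_isomorphic F F.
Proof.
exists (fun X => idm (F X)); split=> [X Y f | X].
  by rewrite comp_idl comp_idr.
by exists (idm (F X)); rewrite comp_idl.
Qed.

Lemma isomorphism_equivalence (C D : category) (F : functor C D) :
  is_isomorphism F -> is_equivalence F.
Proof.
by case=> G [GF FG]; exists G; rewrite GF FG; split;
  apply: naturally_isomorphic_refl.
Qed.

(** * Equality of modules *)

(** A type synonym carries the new scalar multiplication, so that it never
competes with a module structure that [V] may already have. *)
Section ModuleOf.
Variables (B : pzRingType) (V : zmodType) (sc : B -> V -> V).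

Definition module_sort : Type := V.
HB.instance Definition _ := GRing.Zmodule.on module_sort.

Hypotheses (scA : forall a b v, sc a (sc b v) = sc (a * b) v)
  (sc1 : left_id 1 sc) (scDr : right_distributive sc +%R)
  (scDl : forall v, {morph sc^~ v : a b / a + b}).

Definition module_of : lmodType B :=
  HB.pack module_sort
    (GRing.Zmodule_isLmodule.Build B module_sort scA sc1 scDr scDl).

End ModuleOf.

(** When [V] is itself the additive group of a module [M], the additive and
decidability structures of [module_of] are those of [M] by computation. Only
the scalar multiplication and proofs of propositions remain to be compared. *)
Lemma module_of_eq (B : pzRingType) (M : lmodType B) (sc : B -> M -> M)
    scA sc1 scDr scDl :
  (forall b s, sc b s = b *: s) -> @module_of B M sc scA sc1 scDr scDl = M.
Proof.
case: M sc scA sc1 scDr scDl => T [? ? ? ? ? ? ? ? ? [m m1 m2 m3 m4 m5]] /=.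
move=> sc scA sc1 scDr scDl scE.
have {scE} scE : sc = m by apply: funext => b; apply: funext => s; apply: scE.
subst sc.
rewrite /module_of /=.
congr (GRing.Lmodule.Pack (@GRing.Lmodule.Class _ _ _ _ _ _ _ _ _ _ _ _)).
by congr GRing.Nmodule_isLSemiModule.Axioms_; apply: Prop_irrelevance.
Qed.

(** The transport is expressed along an arbitrary equality [e] of carriers,
not the one induced by [p]: when the carriers are convertible, [e] can be
taken to be [erefl], and then the right-hand side is just [s]. *)
Lemma eq_hom_lmodE (B : pzRingType) (M N : lmod_cat B) (p : M = N)
    (e : GRing.Lmodule.sort M = GRing.Lmodule.sort N)
    (s : GRing.Lmodule.sort M) :
  (eq_hom p : {linear M -> N}) s = eq_rect _ id s _ e.
Proof. by case: N / p e => e; rewrite (Prop_irrelevance e erefl). Qed.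

Section IntModules.
Variables (R : comPzRingType) (n : nat) (A : twistedDiffAlg R n).

(** As above, [e] is free so that it can be [erefl] for convertible
carriers. *)
Lemma intModule_ext (L L' : lmodType A) (p : L = L')
    (e : GRing.Lmodule.sort L = GRing.Lmodule.sort L')
    (d : 'I_n -> L -> L) (d' : 'I_n -> L' -> L') dP d'P h h' :
  (forall i s, eq_rect _ id (d i s) _ e = d' i (eq_rect _ id s _ e)) ->
  exist (@integrable R n A) (@DModule R n A L d dP) h
  = exist (@integrable R n A) (@DModule R n A L' d' d'P) h'.
Proof.
case: L' / p e d' d'P h' => e; rewrite (Prop_irrelevance e erefl) /=.
move=> d' d'P h' dE.
have {}dE : d = d' by apply: funext => i; apply: funext => s; apply: dE.
case: d' / dE d'P h' => d'P.
rewrite (Prop_irrelevance d'P dP) => h'.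
by rewrite (Prop_irrelevance h h').
Qed.

Lemma eq_hom_intModuleE (M N : intModule_cat A) (p : M = N)
    (e : GRing.Lmodule.sort (sval M) = GRing.Lmodule.sort (sval N))
    (s : sval M) :
  (eq_hom p : dHom (sval M) (sval N)) s = eq_rect _ id s _ e.
Proof. by case: N / p e => e; rewrite (Prop_irrelevance e erefl). Qed.

End IntModules.

(** * Monomials in commuting operators *)

Section MonomialOperators.
Variables (T : Type) (n : nat) (D : 'I_n -> T -> T).

(** The order of composition is that of the product defining [monomial], so
that both unfold along the same list of indices. *)
Definition mono_op (k : {ffun 'I_n -> nat}) (t : T) : T :=
  foldr (fun i => iter (k i) (D i)) t (index_enum 'I_n).

Definition incr_exp (j : 'I_n) (k : {ffun 'I_n -> nat}) : {ffun 'I_n -> nat} :=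
  [ffun i => ((i == j) + k i)%N].

Hypothesis DC : forall i j t, D i (D j t) = D j (D i t).

Lemma mono_op_incr j k t : D j (mono_op k t) = mono_op (incr_exp j k) t.
Proof.
have iterC i m u : D j (iter m (D i) u) = iter m (D i) (D j u).
  by elim: m => //= m IHm; rewrite DC IHm.
rewrite /mono_op.
have := mem_index_enum j; have := index_enum_uniq 'I_n.
elim: (index_enum _) => //= i r IHr /andP[ir r_uniq].
rewrite inE ffunE; case: eqP => [-> _ /= | /nesym/eqP ij /= jr]; last first.
  by rewrite (negPf ij) add0n iterC IHr.
rewrite eqxx add1n iterS; congr (D _ (iter _ _ _)).
(* The indices are distinct, so the exponents on the rest are unchanged. *)
elim: r ir {IHr r_uniq} => //= i' r IHr; rewrite inE negb_or => /andP[ji' jr].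
by rewrite ffunE eq_sym (negPf ji') add0n IHr.
Qed.

End MonomialOperators.

Lemma monomial_scale (B : pzRingType) (n : nat) (V : lmodType B)
    (d : 'I_n -> B) k (v : V) :
  monomial d k *: v = mono_op (fun i w => d i *: w) k v.
Proof.
rewrite /monomial /mono_op.
elim: (index_enum _) => [|i r IHr]; first by rewrite big_nil scale1r.
rewrite big_cons -scalerA IHr /=; elim: (k i) => [|m IHm].
  by rewrite expr0 scale1r.
by rewrite exprS -scalerA IHm.
Qed.

(** * The action of the Ore extension *)

Lemma collect_terms (I : eqType) (U V : zmodType) (f : I -> {additive U -> V})
    (l : seq (U * I)) :
  \sum_(p <- l) f p.2 p.1
  = \sum_(k <- undup (map snd l)) f k (\sum_(p <- l | p.2 == k) p.1).
Proof.
under [RHS]eq_bigr do rewrite raddf_sum.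
rewrite (exchange_big_dep xpredT) //=; apply: eq_big_seq => p pl.
rewrite -big_filter (_ : [seq _ <- _ | _] = [:: p.2]) ?big_seq1 //.
rewrite -(filter_pred1_uniq (undup_uniq _) (_ : p.2 \in undup (map snd l))).
  by apply: eq_filter => k /=; rewrite eq_sym.
by rewrite mem_undup map_f.
Qed.

Section OreExtension.
Variables (R : comPzRingType) (n : nat) (A : twistedDiffAlg R n).
Variable E : oreExtension A.

(** This is [mono_op_incr] for the operators of left multiplication on [E]
itself, applied to [1]. *)
Lemma ore_d_monomial i k :
  ore_d E i * monomial (ore_d E) k = monomial (ore_d E) (incr_exp i k).
Proof.
have monoE k' : monomial (ore_d E) k'
    = mono_op (fun j (Q : E) => ore_d E j * Q) k' 1.
  by have := @monomial_scale E n E^o (ore_d E) k' 1; rewrite [LHS]mulr1.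
rewrite !monoE; apply: (mono_op_incr (D := fun j Q => ore_d E j * Q)) => j j' Q.
by rewrite !mulrA ore_dC.
Qed.

(** [E] is generated by [A] and the [ore_d E i]. The hypotheses only ask for
stability under left multiplication by generators, which suits statements
about left actions. *)
Lemma ore_ind (Q : E -> Prop) :
  Q 1 -> (forall P P', Q P -> Q P' -> Q (P + P')) ->
  (forall a P, Q P -> Q (ore_of E a * P)) ->
  (forall i P, Q P -> Q (ore_d E i * P)) ->
  forall P, Q P.
Proof.
move=> Q1 QD Qa Qd P; have [s [c ->]] := ore_span P.
have Q0 : Q 0 by rewrite -(mul0r 1) -(rmorph0 (ore_of E)); apply: Qa.
apply: (big_ind Q) => // k _; apply: Qa.
rewrite /monomial; elim/big_rec: _ => // i P' _ QP'.
by elim: (k i) => [|m IHm]; rewrite ?mul1r // exprS -mulrA; apply: Qd.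
Qed.

(** Elements of [E] are represented by lists of terms, where a monomial may be
repeated: sums are then concatenations. *)
Definition ore_eval (l : seq (A * {ffun 'I_n -> nat})) : E :=
  \sum_(p <- l) ore_of E p.1 * monomial (ore_d E) p.2.

Lemma ore_eval_surj P : exists l, P = ore_eval l.
Proof.
have [s [c ->]] := ore_span P; exists [seq (c k, k) | k <- s].
by rewrite /ore_eval big_map.
Qed.

Section Action.
Variables (M : lmodType A) (D : 'I_n -> M -> M).
Hypotheses (DP : forall i, is_derivation i (D i)) (DC : commuting D).

Let DD i s t : D i (s + t) = D i s + D i t.
Proof. by case: (DP i). Qed.

Let DM i x s : D i (x *: s) = tda_der A i x *: s + tda_sigma A i x *: D i s.
Proof. by case: (DP i). Qed.

Let D0 i : D i 0 = 0.
Proof. by apply: (addIr (D i 0)); rewrite -DD !add0r. Qed.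

Definition mod_eval (l : seq (A * {ffun 'I_n -> nat})) (s : M) : M :=
  \sum_(p <- l) p.1 *: mono_op D p.2 s.

(** Freeness of the monomials applies to pairwise distinct exponents, so equal
exponents are collected first, in [E] and in [M] with the same
coefficients. *)
Lemma mod_eval_eq0 l s : ore_eval l = 0 -> mod_eval l s = 0.
Proof.
pose fE k : A -> E := fun a => ore_of E a * monomial (ore_d E) k.
have fE_add k : zmod_morphism (fE k).
  by move=> a b; rewrite /fE rmorphB mulrBl.
pose fM k : A -> M := fun a => a *: mono_op D k s.
have fM_add k : zmod_morphism (fM k).
  by move=> a b; rewrite /fM scalerBl.
pose FE k : {additive A -> E} :=
  HB.pack (fE k) (GRing.isZmodMorphism.Build A E (fE k) (fE_add k)).
pose FM k : {additive A -> M} :=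
  HB.pack (fM k) (GRing.isZmodMorphism.Build A M (fM k) (fM_add k)).
rewrite /ore_eval /mod_eval (collect_terms FE) (collect_terms FM) /=.
move=> /(@ore_free _ _ _ E _ _ (undup_uniq _)) c0.
by rewrite big_seq big1 // => k /c0; rewrite /fM => ->; rewrite scale0r.
Qed.

Lemma mod_eval_eq l l' s :
  ore_eval l = ore_eval l' -> mod_eval l s = mod_eval l' s.
Proof.
pose neg := map (fun p : A * {ffun 'I_n -> nat} => (- p.1, p.2)).
move=> ll'; apply/eqP; rewrite -subr_eq0; apply/eqP.
rewrite -(@mod_eval_eq0 (l ++ neg l') s).
  rewrite /mod_eval big_cat big_map -sumrN /=; congr (_ + _).
  by apply: eq_bigr => p _; rewrite scaleNr.
rewrite /ore_eval big_cat big_map /= -/(ore_eval l) ll' /ore_eval -big_split.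
by rewrite big1 // => p _; rewrite /= rmorphN mulNr addrN.
Qed.

(** The choice of a representing list is harmless by [mod_eval_eq]. *)
Definition act (P : E) (s : M) : M := mod_eval (sval (cid (ore_eval_surj P))) s.

Lemma act_eval l s : act (ore_eval l) s = mod_eval l s.
Proof. by rewrite /act; case: cid => l' /= /mod_eval_eq ->. Qed.

Lemma actDl P P' s : act (P + P') s = act P s + act P' s.
Proof.
have [l ->] := ore_eval_surj P; have [l' ->] := ore_eval_surj P'.
have -> : ore_eval l + ore_eval l' = ore_eval (l ++ l').
  by rewrite /ore_eval big_cat.
by rewrite !act_eval /mod_eval big_cat.
Qed.

Lemma act0 s : act 0 s = 0.
Proof. by apply: (addIr (act 0 s)); rewrite -actDl !add0r. Qed.

Lemma act_term a k s :
  act (ore_of E a * monomial (ore_d E) k) s = a *: mono_op D k s.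
Proof.
by have := act_eval [:: (a, k)] s; rewrite /ore_eval /mod_eval !big_seq1.
Qed.

Lemma act_sum I (r : seq I) (F : I -> E) s :
  act (\sum_(i <- r) F i) s = \sum_(i <- r) act (F i) s.
Proof. exact: (big_morph (act^~ s) (fun _ _ => actDl _ _ s) (act0 s)). Qed.

Lemma act1 s : act 1 s = s.
Proof.
pose k0 : {ffun 'I_n -> nat} := [ffun=> 0%N].
have mono1 : monomial (ore_d E) k0 = 1.
  by rewrite /monomial big1 // => i _; rewrite ffunE.
have op1 : mono_op D k0 s = s.
  by rewrite /mono_op; elim: (index_enum _) => //= i r ->; rewrite ffunE.
by have := act_term 1 k0 s; rewrite rmorph1 mul1r mono1 op1 scale1r.
Qed.

Lemma act_ore_of a P s : act (ore_of E a * P) s = a *: act P s.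
Proof.
have [l ->] := ore_eval_surj P.
rewrite /ore_eval mulr_sumr !act_sum scaler_sumr; apply: eq_bigr => p _.
by rewrite mulrA -rmorphM !act_term scalerA.
Qed.

(** With [P = \sum_k a_k d^k], both sides equal
[\sum_k (D_i(a_k) D^k s + sigma_i(a_k) D_i D^k s)]. *)
Lemma act_ore_d i P s : act (ore_d E i * P) s = D i (act P s).
Proof.
have [l ->] := ore_eval_surj P.
rewrite /ore_eval mulr_sumr !act_sum (big_morph (D i) (DD i) (D0 i)).
apply: eq_bigr => p _.
rewrite mulrA ore_rel mulrDl actDl -mulrA ore_d_monomial !act_term DM.
by rewrite mono_op_incr.
Qed.

(** Both sides transform in the same way when [P] is multiplied on the left by
a generator, so no formula for the product of two monomials with
coefficients is needed. *)
Lemma actM P Q s : act P (act Q s) = act (P * Q) s.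
Proof.
elim/ore_ind: P => [|P P' IHP IHP'|a P IHP|i P IHP].
- by rewrite mul1r act1.
- by rewrite mulrDl !actDl IHP IHP'.
- by rewrite -mulrA !act_ore_of IHP.
- by rewrite -mulrA !act_ore_d IHP.
Qed.

Lemma actDr P s t : act P (s + t) = act P s + act P t.
Proof.
elim/ore_ind: P => [|P P' IHP IHP'|a P IHP|i P IHP].
- by rewrite !act1.
- by rewrite !actDl IHP IHP' addrACA.
- by rewrite !act_ore_of IHP scalerDr.
- by rewrite !act_ore_d IHP DD.
Qed.

Definition ore_module : lmodType E :=
  module_of actM act1 actDr (fun s P P' => actDl P P' s).

Lemma act_unique (sc : E -> M -> M) s :
  (forall t, sc 1 t = t) -> (forall P P' t, sc (P + P') t = sc P t + sc P' t) ->
  (forall a P t, sc (ore_of E a * P) t = a *: sc P t) ->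
  (forall i P t, sc (ore_d E i * P) t = D i (sc P t)) ->
  forall P, act P s = sc P s.
Proof.
move=> sc1 scD sca scd P.
elim/ore_ind: P => [|P P' IHP IHP'|a P IHP|i P IHP].
- by rewrite act1 sc1.
- by rewrite actDl scD IHP IHP'.
- by rewrite act_ore_of sca IHP.
- by rewrite act_ore_d scd IHP.
Qed.

End Action.

(** * The inverse functor *)

Lemma act_dHom (M N : intModule_cat A) (u : dHom (sval M) (sval N)) P s :
  u (act (@dm_der _ _ _ (sval M)) P s) = act (@dm_der _ _ _ (sval N)) P (u s).
Proof.
elim/ore_ind: P => [|P P' IHP IHP'|a P IHP|i P IHP].
- by rewrite !act1.
- by rewrite !actDl -IHP -IHP'; apply: raddfD.
- by rewrite !act_ore_of -IHP; apply: linearZ.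
- rewrite !act_ore_d; first by rewrite dh_der IHP.
  + exact: dm_derP.
  + exact: (svalP N).
  + exact: dm_derP.
  + exact: (svalP M).
Qed.

Definition int_to_ore_obj (M : intModule_cat A) : lmodType E :=
  ore_module (@dm_derP _ _ _ (sval M)) (svalP M).

Section Morphism.
Variables (M N : intModule_cat A) (u : dHom (sval M) (sval N)).

Definition int_to_ore_fun : int_to_ore_obj M -> int_to_ore_obj N := u.

Lemma int_to_ore_fun_linear : linear int_to_ore_fun.
Proof.
move=> P s t; transitivity (u (act (@dm_der _ _ _ (sval M)) P s) + u t).
  exact: (raddfD u).
by rewrite act_dHom.
Qed.

Definition int_to_ore_hom : {linear int_to_ore_obj M -> int_to_ore_obj N} :=
  HB.pack int_to_ore_fun
    (GRing.isLinear.Build E (int_to_ore_obj M) (int_to_ore_obj N) *:%R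
       int_to_ore_fun int_to_ore_fun_linear).

End Morphism.

Definition int_to_ore : functor (intModule_cat A) (lmod_cat E).
Proof.
refine (@Functor (intModule_cat A) (lmod_cat E)
  int_to_ore_obj int_to_ore_hom _ _).
all: by move=> *; apply: linear_ext.
Defined.

Lemma ore_module_ore_act (M : lmodType E) :
  int_to_ore (ore_to_int E M) = M :> lmodType E.
Proof.
apply: (@module_of_eq E M) => P s /=.
apply: (@act_unique _ _ (@ore_act_derivation _ _ _ E M)
  (@ore_act_commuting _ _ _ E M) (fun P (t : M) => P *: t)).
- exact: (@scale1r E M).
- by move=> Q Q' t; apply: (@scalerDl E M).
- by move=> a Q t; apply: esym; apply: (@scalerA E M).
- by move=> i Q t; apply: esym; apply: (@scalerA E M).
Qed.

Lemma ore_act_ore_module (M : intModule_cat A) :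
  ore_to_int E (int_to_ore M) = M.
Proof.
case: M => [[M D DP] DC].
have p : restr (ore_of E) (int_to_ore (exist _ (DModule DP) DC)) = M.
  apply: (@module_of_eq A M) => a s.
  have := act_ore_of D a 1 s; rewrite mulr1 act1; exact.
apply: (@intModule_ext _ _ _ _ _ p erefl) => i s /=.
have := act_ore_d DP DC i 1 s; rewrite mulr1 act1; exact.
Qed.

Lemma ore_to_int_isomorphism : is_isomorphism (ore_to_int E).
Proof.
exists int_to_ore; split.
- apply: (@functor_ext _ _ (functor_comp int_to_ore (ore_to_int E))
    (functor_id _) ore_module_ore_act) => M N f.
  apply: linear_ext => s.
  (* Both equalities of objects have convertible carriers, hence [erefl]. *)
  have eqE L := @eq_hom_lmodE _ _ _ (ore_module_ore_act L) erefl.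
  exact: etrans (eqE N _) (esym (congr1 f (eqE M s))).
- apply: (@functor_ext _ _ (functor_comp (ore_to_int E) int_to_ore)
    (functor_id _) ore_act_ore_module) => M N u.
  apply: dHom_ext => s.
  have eqE L := @eq_hom_intModuleE _ _ _ _ _ (ore_act_ore_module L) erefl.
  exact: etrans (eqE N _) (esym (congr1 u (eqE M s))).
Qed.

End OreExtension.

Theorem proposition5p6 (R : comPzRingType) (n : nat) (A : twistedDiffAlg R n)
    (hA : schwarz_type A) (E : oreExtension A) :
  (forall M : lmodType E,
     (forall i, is_derivation i (ore_act E M i)) /\
     commuting (ore_act E M)) /\
  is_equivalence (ore_to_int E) /\
  is_isomorphism (ore_to_int E).
Proof.
have iso := ore_to_int_isomorphism E.
split; first by split; [exact: ore_act_derivation | exact: ore_act_commuting].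
by split; first exact: isomorphism_equivalence.
Qed.
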